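(* Let $G$ be a finite simple $k$-regular graph without isolated vertices. Then $$s(G)=s_Q(G)\ \ge\ k+1.$$
   Context: For a finite simple graph $G$ on $n$ vertices, let $A_G$ be its adjacency matrix and $D_G$ the diagonal matrix of vertex degrees. The spread of $G$ is $s(G)=\lambda_1-\lambda_n$, where $\lambda_1\ge\cdots\ge\lambda_n$ are the eigenvalues of $A_G$. The signless Laplacian matrix is $Q_G=D_G+A_G$ with eigenvalues $q_1\ge q_2\ge\cdots\ge q_n$, and the signless Laplacian spread is $s_Q(G)=q_1-q_n$. A graph is $k$-regular if every vertex has degree $k$. *)

(* Defs.v *)
From mathcomp Require Import all_boot all_order all_algebra.
From mathcomp Require Import polyrcf.

Set Implicit Arguments.
Unset Strict Implicit.
Unset Printing Implicit Defensive.

Import Order.TTheory GRing.Theory Num.Theory.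
Local Open Scope ring_scope.

(* A finite simple graph is a symmetric irreflexive adjacency relation on the
   finite type of its vertices. *)
Record sgraph := SGraph {
  vertex :> finType;
  adj : rel vertex;
  adj_sym : symmetric adj;
  adj_irr : irreflexive adj
}.

Definition degree (G : sgraph) (v : G) : nat := #|[set w : G | adj v w]|.

Definition isolated (G : sgraph) (v : G) : Prop := forall w : G, ~~ adj v w.

Definition regular (k : nat) (G : sgraph) : Prop :=
  forall v : G, degree v = k.

(* Rows and columns are indexed by the vertices through [enum_val]. *)
Definition adjacency_mx (R : rcfType) (G : sgraph) : 'M[R]_#|G| :=
  \matrix_(i, j) (adj (enum_val i) (enum_val j))%:R.

Definition degree_mx (R : rcfType) (G : sgraph) : 'M[R]_#|G| :=
  diag_mx (\row_i (degree (enum_val i))%:R).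

Definition signless_laplacian_mx (R : rcfType) (G : sgraph) : 'M[R]_#|G| :=
  degree_mx R G + adjacency_mx R G.

(* The eigenvalues in [R] of a square matrix in nonincreasing order, each
   repeated according to its multiplicity as a root of the characteristic
   polynomial. For a symmetric matrix this sequence has length [n]. *)
Definition eigenvalues (R : rcfType) (n : nat) (A : 'M[R]_n) : seq R :=
  sort >=%R (flatten [seq nseq (mup x (char_poly A)) x
                     | x <- rootsR (char_poly A)]).

(* lambda_1 - lambda_n; sequences are indexed from 0. *)
Definition mx_spread (R : rcfType) (n : nat) (A : 'M[R]_n) : R :=
  (eigenvalues A)`_0 - (eigenvalues A)`_n.-1.

Definition spread (R : rcfType) (G : sgraph) : R :=
  mx_spread (adjacency_mx R G).

Definition signless_laplacian_spread (R : rcfType) (G : sgraph) : R :=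
  mx_spread (signless_laplacian_mx R G).

(* Main.v *)
(* On a k-regular graph Q = k I + A, so translating the spectrum gives the
   equality of the spreads. The all-ones vector is an eigenvector of A for k,
   hence lambda_1 >= k. For an edge uv, the vector x = e_u - e_v satisfies
   x A x^T = -2 = - x x^T, hence lambda_n <= -1 by the Rayleigh quotient. *)
Require Import Defs.
From mathcomp Require Import all_boot all_order all_algebra.
From mathcomp Require Import sesquilinear spectral polyrcf complex lra.
Import Order.TTheory GRing.Theory Num.Theory.
Local Open Scope ring_scope.

Lemma char_poly_conj (F : fieldType) (n : nat) (P A : 'M[F]_n) :
  P \in unitmx -> char_poly (invmx P *m A *m P) = char_poly A.
Proof.
move=> Pu; rewrite /char_poly.
have -> : char_poly_mx (invmx P *m A *m P) =
    map_mx polyC (invmx P) *m char_poly_mx A *m map_mx polyC P.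
  rewrite /char_poly_mx mulmxBr mulmxBl -!map_mxM; congr (_ - _).
  by rewrite mul_mx_scalar -scalemxAl -map_mxM mulVmx // map_mx1 scalemx1.
rewrite !det_mulmx mulrAC -det_mulmx -map_mxM mulVmx //.
by rewrite map_mx1 det1 mul1r.
Qed.

Lemma char_poly_addC (F : comNzRingType) (n : nat) (A : 'M[F]_n) (a : F) :
  char_poly (A + a%:M) = char_poly A \Po ('X - a%:P).
Proof.
(* Substituting ['X - a%:P] is a ring morphism, so it passes inside the determinant. *)
rewrite /char_poly -[RHS]/((comp_poly ('X - a%:P)) _) -det_map_mx.
congr (\det _); apply/matrixP => i j; rewrite !mxE.
rewrite raddfB /= raddfMn /= comp_polyX comp_polyC polyCD polyCMn mulrnBl opprD.
by rewrite addrA addrAC.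
Qed.

(** Over [R[i]] the matrix is Hermitian, hence unitarily diagonalizable with real diagonal; both
    claims are read off there and pulled back to [R]. The second is the Rayleigh lower bound. *)
Lemma symmetric_mx_spectrum (R : rcfType) (n : nat) (A : 'M[R]_n) :
  A^T = A ->
  exists d : 'I_n -> R, char_poly A = \prod_i ('X - (d i)%:P) /\
    forall (m : R) (x : 'rV_n), (forall i, m <= d i) ->
      m * (x *m x^T) 0 0 <= (x *m A *m x^T) 0 0.
Proof.
move=> Asym; pose toC := real_complex R; pose B := map_mx toC A.
have Bherm : B \is hermsymmx.
  apply/is_hermitianmxP; rewrite expr0 scale1r; apply/matrixP => i j.
  by rewrite !mxE -[in LHS]Asym mxE; exact/esym/conjc_real.
have /hermitian_normalmx/orthomx_spectralP := Bherm.
set P := spectralmx B; set D := spectral_diag B => Bdiag.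
have Punit : P \is unitarymx by exact: spectral_unitarymx.
have Dreal i : D 0 i = toC (complex.Re (D 0 i)).
  have /mxOverP Dr := hermitian_spectral_diag_real Bherm.
  by rewrite [RHS]RRe_real.
exists (fun i => complex.Re (D 0 i)); split.
  apply: (map_poly_inj toC); rewrite map_char_poly -/B Bdiag.
  rewrite char_poly_conj ?unitarymx_unit // char_poly_trig ?diag_mx_is_trig //.
  rewrite rmorph_prod; apply: eq_bigr => i _.
  by rewrite !mxE eqxx mulr1n rmorphB /= map_polyX map_polyC [in LHS]Dreal.
move=> m x md; pose X := map_mx toC x; pose y := X *m (P ^t*)%sesqui.
have XtE : (X ^t*)%sesqui = map_mx toC x^T.
  by apply/matrixP => i j; rewrite !mxE; exact: conjc_real.
have ytE : (y ^t*)%sesqui = P *m (X ^t*)%sesqui.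
  by rewrite /y trmx_mul map_mxM trmxCK.
(* Since [y] holds the coordinates of [x] in the eigenbasis, [w = 1] will give the squared norm of
   [x] and [w = D] its quadratic form under [A]. *)
have quadE (w : 'rV[R[i]]_n) :
    (y *m diag_mx w *m (y ^t*)%sesqui) 0 0 = \sum_i w 0 i * `|y 0 i| ^+ 2.
  rewrite mul_mx_diag mxE; apply: eq_bigr => i _.
  by rewrite !mxE normCK mulrAC mulrC.
have normE : toC ((x *m x^T) 0 0) = \sum_i `|y 0 i| ^+ 2.
  transitivity ((y *m diag_mx (const_mx 1) *m (y ^t*)%sesqui) 0 0).
    rewrite diag_const_mx mulmx1 ytE /y -mulmxA (mulmxA _ P) -invmx_unitary //.
    by rewrite mulVmx ?unitarymx_unit // mul1mx XtE -map_mxM [RHS]mxE.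
  by rewrite quadE; apply: eq_bigr => i _; rewrite mxE mul1r.
have formE : toC ((x *m A *m x^T) 0 0) = \sum_i D 0 i * `|y 0 i| ^+ 2.
  rewrite -quadE ytE /y -invmx_unitary // !mulmxA -(mulmxA X) -(mulmxA X).
  by rewrite -Bdiag XtE -!map_mxM [RHS]mxE.
suff : toC m * toC ((x *m x^T) 0 0) <= toC ((x *m A *m x^T) 0 0).
  by rewrite -rmorphM lecR.
rewrite normE formE mulr_sumr ler_sum // => i _.
by rewrite ler_wpM2r ?exprn_ge0 // Dreal lecR.
Qed.

(** Both lists contain each [y] as often as its multiplicity as a root, so they are permutations of
    each other and sort alike. *)
Lemma eigenvaluesE (R : rcfType) (n : nat) (A : 'M[R]_n) (s : seq R) :
  char_poly A = \prod_(x <- s) ('X - x%:P) -> eigenvalues A = sort >=%R s.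
Proof.
move=> charA; apply/perm_sortP.
- exact: ge_total.
- exact: ge_trans.
- exact: ge_anti.
have nz : char_poly A != 0 by exact/monic_neq0/char_poly_monic.
apply/allP => y _ /=; apply/eqP; rewrite -(mu_prod_XsubC y s) -charA.
rewrite count_flatten -map_comp sumnE big_map.
rewrite (eq_bigr (fun x => (x == y) * mup x (char_poly A))%N); last first.
  by move=> x _; rewrite /= count_nseq.
(* If [y] is a root, only its own block contributes to the count; otherwise both sides are 0. *)
have [yr|yNr] := boolP (y \in rootsR (char_poly A)).
  rewrite (bigD1_seq y) ?uniq_roots //= eqxx mul1n big1 ?addn0 //.
  by move=> x /negPf ->.
rewrite big_seq big1 ?mupNroot //; last first.
  by move=> x xr; case: eqP => // xy; rewrite -xy xr in yNr.
by apply: contra yNr => ry; rewrite -(roots_on_rootsR nz) in_itv.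
Qed.

Lemma symmetric_eigenvaluesP (R : rcfType) (n : nat) (A : 'M[R]_n) :
  A^T = A ->
  [/\ char_poly A = \prod_(x <- eigenvalues A) ('X - x%:P),
      size (eigenvalues A) = n &
      forall x : 'rV_n, (eigenvalues A)`_n.-1 * (x *m x^T) 0 0
                          <= (x *m A *m x^T) 0 0].
Proof.
move=> /symmetric_mx_spectrum[d [charA dP]].
have {}charA : char_poly A = \prod_(x <- codom d) ('X - x%:P).
  by rewrite charA /codom big_map enumT.
have eigA := eigenvaluesE _ _ _ _ charA.
have sz : size (eigenvalues A) = n by rewrite eigA size_sort size_codom card_ord.
split=> // [|x]; first by rewrite eigA charA; apply/perm_big; rewrite perm_sym perm_sort.
apply: dP => i; have di : d i \in eigenvalues A by rewrite eigA mem_sort codom_f.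
(* The position of [d i] is below [n], so [n] is positive and [n.-1] is a valid position, at or
   after that of [d i] in a nonincreasing list. *)
have ilt := di; rewrite -index_mem sz in ilt.
rewrite -[leRHS](nth_index 0 di).
apply: (sorted_leq_nth (leT := >=%R)); rewrite ?inE ?sz ?prednK ?(leq_ltn_trans _ ilt) //.
- exact: ge_trans.
- exact: lexx.
- by rewrite eigA sort_sorted //; exact: ge_total.
- by rewrite -ltnS prednK // (leq_ltn_trans _ ilt).
Qed.

Lemma le_eigenvalues_head (R : rcfType) (n : nat) (A : 'M[R]_n) (a : R) :
  A^T = A -> eigenvalue A a -> a <= (eigenvalues A)`_0.
Proof.
move=> /symmetric_eigenvaluesP[charA _ _]; rewrite eigenvalue_root_char charA.
rewrite root_prod_XsubC => aA; rewrite -[leLHS](nth_index 0 aA).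
apply: (sorted_leq_nth (leT := >=%R)); rewrite ?inE ?index_mem //.
- exact: ge_trans.
- exact: lexx.
- by rewrite /eigenvalues sort_sorted //; exact: ge_total.
- by case: (eigenvalues A) aA.
Qed.

(** The characteristic polynomial splits because [A] is symmetric, so its translate splits at the
    shifted roots; adding [a] keeps the list sorted. *)
Lemma eigenvalues_addC (R : rcfType) (n : nat) (A : 'M[R]_n) (a : R) :
  A^T = A -> eigenvalues (A + a%:M) = [seq x + a | x <- eigenvalues A].
Proof.
move=> /symmetric_eigenvaluesP[charA _ _].
rewrite [LHS](eigenvaluesE _ _ _ [seq x + a | x <- eigenvalues A]).
  apply/sorted_sort; first exact: ge_trans.
  rewrite sorted_map; apply: (sub_sorted (e := >=%R)).
    by move=> x y /= xy; rewrite lerD2r.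
  by rewrite /eigenvalues sort_sorted //; exact: ge_total.
rewrite char_poly_addC charA rmorph_prod big_map; apply: eq_bigr => x _ /=.
by rewrite raddfB /= comp_polyX comp_polyC polyCD opprD addrA addrAC.
Qed.

Lemma mx_spread_addC (R : rcfType) (n : nat) (A : 'M[R]_n) (a : R) :
  (0 < n)%N -> A^T = A -> mx_spread (A + a%:M) = mx_spread A.
Proof.
move=> n_gt0 Asym; have [_ sz _] := symmetric_eigenvaluesP _ _ _ Asym.
(* Positivity of [n] puts positions 0 and [n.-1] in range; the default value 0 would not be shifted
   by [a]. *)
rewrite /mx_spread eigenvalues_addC // !(nth_map 0) ?sz ?prednK //.
by rewrite opprD addrACA subrr addr0.
Qed.

Lemma tr_adjacency_mx (R : rcfType) (G : sgraph) :
  (adjacency_mx R G)^T = adjacency_mx R G.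
Proof. by apply/matrixP => i j; rewrite !mxE adj_sym. Qed.

Lemma regular_signless_laplacian (R : rcfType) (G : sgraph) (k : nat) :
  regular k G -> signless_laplacian_mx R G = adjacency_mx R G + k%:R%:M.
Proof.
move=> Greg; rewrite /signless_laplacian_mx addrC; congr (_ + _).
by apply/matrixP => i j; rewrite !mxE Greg.
Qed.

Lemma regular_eigenvalue (R : rcfType) (G : sgraph) (k : nat) :
  (0 < #|G|)%N -> regular k G -> eigenvalue (adjacency_mx R G) k%:R.
Proof.
move=> G_gt0 Greg; apply/eigenvalueP; exists (const_mx 1); last first.
  apply/eqP => /rowP/(_ (Ordinal G_gt0)); rewrite !mxE => /eqP.
  by rewrite oner_eq0.
(* Each column sum of the adjacency matrix is the degree of a vertex; [enum_val] carries the sum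
   over vertices to one over indices. *)
apply/rowP => j; rewrite !mxE mulr1 -(Greg (enum_val j)) /degree -sum1_card.
rewrite natr_sum [RHS](reindex (@enum_val _ G)) /=.
  rewrite [RHS]big_mkcond /=; apply: eq_bigr => i _; rewrite !mxE mul1r inE adj_sym.
  by case: (adj _ _).
exact/onW_bij/enum_val_bij.
Qed.

Lemma adjacency_min_eigenvalue (R : rcfType) (G : sgraph) (u v : G) :
  adj u v -> (eigenvalues (adjacency_mx R G))`_#|G|.-1 <= -1.
Proof.
move=> uv; set A := adjacency_mx R G.
have [_ _ ray] := symmetric_eigenvaluesP _ _ _ (tr_adjacency_mx R G).
pose i := enum_rank u; pose j := enum_rank v.
pose x : 'rV[R]_#|G| := delta_mx 0 i - delta_mx 0 j.
have ij : i != j.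
  by apply/eqP => /enum_rank_inj uvE; rewrite uvE adj_irr in uv.
have form (B : 'M[R]_#|G|) :
    (x *m B *m x^T) 0 0 = B i i - B j i - (B i j - B j j).
  rewrite /x raddfB /= !trmx_delta mulmxBl -!rowE mulmxBr -!colE.
  by rewrite !mxE.
(* The same formula gives 2 at the identity and -2 at the adjacency matrix, so the Rayleigh bound
   says that twice the last eigenvalue is at most -2. *)
have normx := form 1%:M; rewrite mulmx1 in normx.
move: (ray x); rewrite normx form !mxE !enum_rankK !adj_irr (adj_sym v) uv.
by rewrite !eqxx (negPf ij) eq_sym (negPf ij) /A /=; lra.
Qed.

Theorem theorem29 (R : rcfType) (G : sgraph) (k : nat)
    (G_nonempty : (0 < #|G|)%N)
    (G_regular : regular k G)
    (G_no_isolated : forall v : G, ~ isolated v) :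
  spread R G = signless_laplacian_spread R G /\ spread R G >= k%:R + 1.
Proof.
have Asym := tr_adjacency_mx R G; split.
  rewrite /spread /signless_laplacian_spread.
  by rewrite (regular_signless_laplacian _ _ _ G_regular) mx_spread_addC.
have [u _] : exists u : G, u \in G by apply/card_gt0P.
(* The hypothesis only refutes [isolated u]; a finite search turns this into an actual neighbour. *)
have [v uv|noadj] := pickP (adj u); last first.
  by case: (G_no_isolated u) => w; rewrite noadj.
rewrite /spread /mx_spread lerD //.
  by rewrite le_eigenvalues_head // regular_eigenvalue.
by rewrite lerNr (adjacency_min_eigenvalue _ _ _ _ uv).
Qed.
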